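(* Let $c>0$, $D>0$, $k>0$ and let $u(\theta,\varphi,t)$ be the solution of the initial value problem described in the context, with approximation of truncation degree $L\in\mathbb N$ \[ u_L(\theta ,\varphi ,t) = \exp\left(-\frac{c^{2}t}{2D}\right)\sum_{l=0}^{L-1}\sum_{m=-l}^{l}Y_{lm}(\theta ,\varphi )\xi _{lm}(t). \] Then there is a constant $C$ such that for $t>0$ the truncation error is bounded by \[ \|u(\theta ,\varphi ,t)-u_L(\theta ,\varphi ,t)\|_{L_2(\Omega \times \mathbb S^{2})} \le C\left(\sum_{l=L}^{\infty }(2l+1)C_{l}\right)^{1/2}. \] Moreover, for $L>\frac{\sqrt{D^{2}k^{2}+c^{2}}-Dk}{2Dk}$ it holds \[ \|u(\theta ,\varphi ,t)-u_L(\theta ,\varphi ,t)\|_{L_2(\Omega \times \mathbb S^{2})}\le C\exp\left( -\frac{c^{2}t}{2D}\right)\left(\sum_{l=L}^{\infty}(2l+1)C_{l}\right)^{1/2}, \] where the constant $C$ depends only on the parameters $c$, $D$ and $k$.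
   Context: On the unit sphere $\mathbb{S}^2$ with coordinates $(\theta,\varphi)\in[0,\pi)\times[0,2\pi)$ and measure $\sin\theta\,d\theta\,d\varphi$, $Y_{lm}(\theta,\varphi)=d_{lm}e^{im\varphi}P_l^m(\cos\theta)$, $d_{lm}=(-1)^m\big[\frac{(2l+1)(l-m)!}{4\pi(l+m)!}\big]^{1/2}$, are the complex spherical harmonics; $\mathbf{0}$ denotes $\theta=\varphi=0$. Let $T=\sum_{l\ge0}\sum_{m=-l}^l a_{lm}Y_{lm}$ be a real Gaussian isotropic random field: $a_{lm}$ complex Gaussian with $a_{lm}=(-1)^ma_{l,-m}$, $\mathbf E a_{lm}=0$, $\mathbf E a_{lm}\overline{a_{l'm'}}=\delta_l^{l'}\delta_m^{m'}C_l$, independent for $m\ne -m'$, with angular power spectrum satisfying $\sum_l(2l+1)C_l<\infty$. The solution of $\frac{1}{c^2}u_{tt}+\frac1D u_t=k^2\Delta_{(\theta,\varphi)}u$ ($\Delta_{(\theta,\varphi)}$ the Laplace–Beltrami operator), $u|_{t=0}=T$, $u_t|_{t=0}=0$, is the $L_2(\Omega\times\mathbb S^2)$-convergent series $u(\theta,\varphi,t)=\exp(-\frac{c^2t}{2D})\sum_{l\ge0}\sum_{m=-l}^lY_{lm}(\theta,\varphi)\xi_{lm}(t)$ with $\xi_{lm}(t)=\sqrt{\frac{4\pi}{2l+1}}a_{lm}\overline{Y_{l0}(\mathbf 0)}[A_l(t)+B_l(t)]$, where, with $K_l=\sqrt{\frac{c^4}{4D^2}-c^2l(l+1)k^2}$,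 $K_l'=\sqrt{c^2l(l+1)k^2-\frac{c^4}{4D^2}}$, $l^*=\frac{\sqrt{D^2k^2+c^2}-Dk}{2Dk}$: $A_l(t)=[\cosh(tK_l)+\frac{c^2}{2DK_l}\sinh(tK_l)]\mathbf 1_{\{l\le l^*\}}$, $B_l(t)=[\cos(tK_l')+\frac{c^2}{2DK_l'}\sin(tK_l')]\mathbf 1_{\{l>l^*\}}$ (with $\sinh(tK_l)/K_l:=t$ if $K_l=0$). $\|X\|_{L_2(\Omega\times\mathbb S^2)}$ denotes $(\mathbf E\int_{\mathbb S^2}|X|^2\sin\theta\,d\theta\,d\varphi)^{1/2}$.
   Formalization: The reality condition is read as a_{l,-m} = (-1)^m times the conjugate of a_{lm} (without the conjugate, C_l = 0 for all l ≥ 1), and independence is required of a_{lm} and a_{l'm'} for distinct index pairs except when l = l' and m = -m'. *)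

(* Defs.v *)
From HB Require Import structures.
From mathcomp Require Import all_boot all_order all_algebra.
From mathcomp Require Import all_classical all_reals all_analysis.
From mathcomp Require Import complex.
Set Implicit Arguments.
Unset Strict Implicit.
Unset Printing Implicit Defensive.
Import Order.TTheory GRing.Theory Num.Theory.
Import numFieldNormedType.Exports.
Local Open Scope classical_set_scope.
Local Open Scope ring_scope.

Section Defs.
Variable R : realType.

Definition cosh (x : R) : R := (expR x + expR (- x)) / 2.
Definition sinh (x : R) : R := (expR x - expR (- x)) / 2.

(* Legendre polynomial via Rodrigues' formula *)
Definition legendre (l : nat) : {poly R} :=
  ((2 ^ l * l`!)%:R)^-1 *: (((('X ^+ 2 - 1) ^+ l) : {poly R})^`(l)).

(* associated Legendre function P_l^m (no Condon-Shortley phase, the sign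
   (-1)^m being part of d_lm), with P_l^{-m} = (-1)^m (l-m)!/(l+m)! P_l^m *)
Definition assoc_legendre (l : nat) (m : int) (x : R) : R :=
  let n := `|m|%N in
  let p := Num.sqrt (1 - x ^+ 2) ^+ n * ((legendre l)^`(n)).[x] in
  if (0 <= m)%R then p
  else (-1) ^+ n * (((l - n)%N)`!)%:R / (((l + n)%N)`!)%:R * p.

Definition dcoef (l : nat) (m : int) : R :=
  (-1) ^+ `|m|%N * Num.sqrt ((2 * l + 1)%N%:R * ((absz (l%:Z - m))`!)%:R
                             / (4 * pi * ((absz (l%:Z + m))`!)%:R)).

Definition Ylm (l : nat) (m : int) (theta phi : R) : R[i] :=
  ((dcoef l m * assoc_legendre l m (cos theta))%:C
    * (cos (m%:~R * phi) +i* sin (m%:~R * phi)))%C.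

Definition sqmod (z : R[i]) : R := complex.Re z ^+ 2 + complex.Im z ^+ 2.

Variables (c D k : R).

Definition lstar : R := (Num.sqrt (D ^+ 2 * k ^+ 2 + c ^+ 2) - D * k) / (2 * D * k).
Definition Kl (l : nat) : R :=
  Num.sqrt (c ^+ 4 / (4 * D ^+ 2) - c ^+ 2 * (l * l.+1)%:R * k ^+ 2).
Definition Kl' (l : nat) : R :=
  Num.sqrt (c ^+ 2 * (l * l.+1)%:R * k ^+ 2 - c ^+ 4 / (4 * D ^+ 2)).

Definition sinh_div (t K : R) : R := if K == 0 then t else sinh (t * K) / K.

Definition Al (l : nat) (t : R) : R :=
  if (l%:R <= lstar)%R then cosh (t * Kl l) + c ^+ 2 / (2 * D) * sinh_div t (Kl l)
  else 0.
Definition Bl (l : nat) (t : R) : R :=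
  if (lstar < l%:R)%R then cos (t * Kl' l) + c ^+ 2 / (2 * D * Kl' l) * sin (t * Kl' l)
  else 0.

Context {d : measure_display} {T : measurableType d}.

Definition xi (a : nat -> int -> T -> R[i]) (l : nat) (m : int) (t : R) (w : T) : R[i] :=
  ((Num.sqrt (4 * pi / (2 * l + 1)%N%:R))%:C * a l m w * conjc (Ylm l 0 0 0)
    * (Al l t + Bl l t)%:C)%C.

Definition usum (a : nat -> int -> T -> R[i]) (t : R) (lo hi : nat)
  (w : T) (theta phi : R) : R[i] :=
  ((expR (- (c ^+ 2 * t) / (2 * D)))%:C *
   \sum_(lo <= l < hi) \sum_(j < (2 * l).+1)
      Ylm l (j%:Z - l%:Z) theta phi * xi a l (j%:Z - l%:Z) t w)%C.

End Defs.

Section Prob.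
Context {R : realType} {d : measure_display} {T : measurableType d}.
Variable P : probability T R.
Local Open Scope ereal_scope.

Definition L2sq (X : T -> R -> R -> R[i]) : \bar R :=
  \int[P]_w \int[lebesgue_measure]_(theta in `[0%R, pi[)
     \int[lebesgue_measure]_(phi in `[0%R, (2 * pi)%R[)
        (sqmod (X w theta phi) * sin theta)%:E.

Definition L2norm (X : T -> R -> R -> R[i]) : \bar R :=
  match L2sq X with
  | r%:E => (Num.sqrt r)%:E
  | +oo => +oo
  | -oo => -oo
  end.

Definition cexpect_is (Z : T -> R[i]) (z : R[i]) : Prop :=
  [/\ P.-integrable setT (fun w => (complex.Re (Z w))%:E),
      P.-integrable setT (fun w => (complex.Im (Z w))%:E),
      \int[P]_w (complex.Re (Z w))%:E = (complex.Re z)%:E &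
      \int[P]_w (complex.Im (Z w))%:E = (complex.Im z)%:E].

Definition rgaussian (Y : T -> R) : Prop :=
  exists (mu s : R),
    (s = 0%R /\ P [set w | Y w != mu] = 0)
    \/ ((0 < s)%R /\ forall A : set R, measurable A ->
          P (Y @^-1` A) = normal_prob mu s A).

(* complex Gaussian: (Re Z, Im Z) jointly Gaussian *)
Definition cgaussian (Z : T -> R[i]) : Prop :=
  forall alpha beta : R,
    rgaussian (fun w => alpha * complex.Re (Z w) + beta * complex.Im (Z w))%R.

Definition cindep (X Y : T -> R[i]) : Prop :=
  forall A B : set (R * R)%type, measurable A -> measurable B ->
    P ([set w | A (complex.Re (X w), complex.Im (X w))]
       `&` [set w | B (complex.Re (Y w), complex.Im (Y w))])
    = P [set w | A (complex.Re (X w), complex.Im (X w))]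
      * P [set w | B (complex.Re (Y w), complex.Im (Y w))].

Definition isotropic_gaussian_coeffs (a : nat -> int -> T -> R[i]) (Cl : nat -> R) : Prop :=
  (forall l m, (`|m| <= l)%N ->
         measurable_fun setT (fun w => complex.Re (a l m w)) /\
         measurable_fun setT (fun w => complex.Im (a l m w))) /\
  (forall l m, (`|m| <= l)%N -> cgaussian (a l m)) /\
  (forall l m, (`|m| <= l)%N -> cexpect_is (a l m) 0%R) /\
  (* reality condition a_{l,-m} = (-1)^m conj(a_lm) *)
  (forall l m w, (`|m| <= l)%N -> a l (- m)%R w = ((-1) ^+ `|m|%N * conjc (a l m w))%R) /\
  (forall l m l' m', (`|m| <= l)%N -> (`|m'| <= l')%N ->
         cexpect_is (fun w => a l m w * conjc (a l' m' w))%R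
           (if (l == l') && (m == m') then real_complex R (Cl l) else 0%R)) /\
  (forall l m l' m', (`|m| <= l)%N -> (`|m'| <= l')%N ->
         (l, m) <> (l', m') -> ~ (l = l' /\ m = (- m')%R) ->
         cindep (a l m) (a l' m')).

End Prob.

(* Main.v *)
(** The coefficients are pairwise uncorrelated, so for [L <= N] and a fixed point of the
    sphere
      [E |u_N - u_L|^2 = e^2 sum_{L<=l<N} (A_l+B_l)^2 C_l (2l+1) / (4 pi)],
    where [e = exp(-c^2 t / 2D)], because [sum_m |Y_lm|^2] equals [(2l+1) / (4 pi)]
    by the addition theorem on the diagonal.  Tonelli's theorem turns
    this into a bound of the [L_2(Omega x S^2)] norm, and [N -> oo] together with
    [|x+y|^2 <= 2|x|^2 + 2|y|^2] yields the claim, since [e |A_l+B_l|] is bounded by a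
    constant of [c, D, k], as is [|A_l+B_l| = |B_l|] itself for [l > l^*]. *)
Require Import Defs.
From HB Require Import structures.
From mathcomp Require Import all_boot all_order all_algebra.
From mathcomp Require Import all_classical all_reals all_analysis.
From mathcomp Require Import complex measurable_realfun.
From mathcomp Require Import ring lra zify.
Import Order.TTheory GRing.Theory Num.Theory.
Import numFieldNormedType.Exports.
Local Open Scope classical_set_scope.
Local Open Scope ring_scope.

(** The field [U] is given only as a mean-square limit, so second moments are computed for finite
    blocks [L <= l < N] alone, and everything is estimated on [L2sq]; the square root is taken once,
    at the very end. One estimate serves both claims: it accepts any [K] that bounds [e |A_l + B_l|]
    for all [l >= L], and is used with [K = M] and with [K = M e]. The delicate point in finding [M]
    is division by a small frequency. Up to [lstar] the growth rate [K_l] never exceeds the damping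
    rate [b = c^2 / (2 D)], but [b / K_l] has no bound near [K_l = 0], so small and large [K_l] are
    treated apart. Beyond [lstar] the frequencies increase with [l], so the least integer degree
    above [lstar] controls all amplitudes. The final constant is [sqrt pi * M]: under the root,
    [2 pi^2] bounds the area of the sphere, [1 / (4 pi)] comes from the addition theorem, and 2 from
    the inequality for [|x + y|^2]. *)

(** * Legendre polynomials and the addition theorem on the diagonal *)

Lemma deriv_natr (R : nzRingType) (n : nat) : (n%:R : {poly R})^`() = 0.
Proof. by rewrite -polyC_natr derivC. Qed.

(** The power [w] satisfies [(X^2 - 1) w' = 2 l X w]; differentiating this relation [j + 1] times
    gives the identity. *)
Lemma derivn_rodrigues (R : comNzRingType) (l j : nat) :
  let w := ('X^2 - 1) ^+ l : {poly R} in
  ('X^2 - 1) * w^`(j.+2) + (2 * j.+1%:R - 2 * l%:R) * 'X * w^`(j.+1)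
    + j.+1%:R * (j%:R - 2 * l%:R) * w^`(j) = 0.
Proof.
move=> w.
have d0 := deriv_natr R.
have d1 : (1 : {poly R})^`() = 0 by rewrite (d0 1%N).
have dX2 : ('X^2 - 1 : {poly R})^`() = 2 * 'X.
  by rewrite derivB derivXn d1 /= expr1 subr0 -mulr_natl.
have w1 : ('X^2 - 1) * w^`() = 2 * l%:R * 'X * w.
  rewrite /w; case: l {w} => [|l]; first by rewrite expr0 d1; ring.
  by rewrite deriv_exp dX2 /= -mulr_natl -natr1 (exprS _ l); ring.
elim: j => [|j IH].
  rewrite derivn0 derivn1 derivnS derivn1.
  have := congr1 deriv w1; rewrite !derivM dX2 !d0 derivX => e.
  apply/eqP; rewrite -subr_eq0 -[0 in X in X == _](subrr (w * 0)); apply/eqP.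
  by move/eqP: e; rewrite -subr_eq0 => /eqP <-; ring.
have := congr1 deriv IH.
rewrite !(dX2, d0, derivD, derivM, derivN, derivX, deriv0) -!derivnS => <-.
by rewrite -[j.+2%:R]natr1 -[j.+1%:R]natr1; ring.
Qed.

(** This is the preceding identity at [j = l + m], since the [m]-th derivative of the Legendre
    polynomial is a multiple of the [(l + m)]-th derivative of [(X^2 - 1)^l]. *)
Lemma legendre_ode (R : realType) (l m : nat) :
  (1 - 'X^2) * (legendre R l)^`(m.+2)
    = (2 * m.+1%:R) * 'X * (legendre R l)^`(m.+1)
      + (m%:R - l%:R) * (l%:R + m%:R + 1) * (legendre R l)^`(m).
Proof.
rewrite /legendre !derivnZ.
set w := (_ ^+ l).
have dD i : (w^`(l))^`(i) = w^`(l + i).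
  by elim: i => [|i IH]; rewrite ?addn0 // addnS derivnS IH.
have := derivn_rodrigues R l (l + m); rewrite -/w /= => e.
rewrite !dD -!scalerAr -scalerDr; congr (_ *: _).
apply/eqP; rewrite -subr_eq0; apply/eqP; rewrite -[RHS]oppr0 -[in RHS]e.
by rewrite -!natr1 !natrD; ring.
Qed.

Lemma size_legendre (R : realType) (l : nat) : (size (legendre R l) <= l.+1)%N.
Proof.
apply/leq_sizeP => j lj; rewrite coefZ coef_derivn.
suff -> : (('X^2 - 1) ^+ l : {poly R})`_(l + j) = 0 by rewrite mul0rn mulr0.
apply: (leq_sizeP _ _ _ (l + j) (leqnn _)).
apply: (leq_trans (size_poly_exp_leq _ _)).
by rewrite -(polyC1 R) size_XnsubC //=; lia.
Qed.

(** In the Leibniz expansion only the term where all [j] derivatives fall on the power keeps as few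
    as [l - j] factors [X - a]; [r] collects the others. At [j = l] it yields the value of the
    derivative at [a]. *)
Lemma derivn_exp_root (R : comNzRingType) (l j : nat) (a : R) (q : {poly R}) :
  (j <= l)%N ->
  exists r, (('X - a%:P) ^+ l * q)^`(j)
    = ('X - a%:P) ^+ (l - j) * ((l ^_ j)%:R * q + ('X - a%:P) * r).
Proof.
elim: j => [|j IH] jl.
  by exists 0; rewrite ffactn0 derivn0 subn0 mulr0 addr0 mul1r.
have [r E] := IH (ltnW jl).
rewrite derivnS E.
have -> : (l - j)%N = (l - j.+1).+1 by lia.
set n := (l - j.+1)%N.
(* The remainder is read off the product rule: [n + 1] copies of [r] come from the power and one
   more from the factor [X - a] in front of [r]. *)
exists ((l ^_ j)%:R * q^`() + n.+2%:R * r + ('X - a%:P) * r^`()).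
have -> : ((l ^_ j.+1)%:R : {poly R}) = (l ^_ j)%:R * n.+1%:R.
  by rewrite ffactnSr natrM; congr (_ * _%:R); rewrite /n; lia.
move: (derivXsubC a); set d := 'X - a%:P => dd.
rewrite !(dd, deriv_natr, derivM, derivD) deriv_exp dd /=.
by rewrite -mulr_natl -[n.+2%:R]natr1 -[n.+1%:R]natr1 exprS; ring.
Qed.

(** With [X^2 - 1 = (X - 1) (X + 1)], the [l]-th derivative at 1 is [l! 2^l], which the Rodrigues
    prefactor cancels. *)
Lemma legendre1 (R : realType) (l : nat) : (legendre R l).[1] = 1.
Proof.
rewrite /legendre hornerZ.
have -> : ('X^2 - 1) ^+ l = ('X - 1%:P) ^+ l * ('X + 1) ^+ l :> {poly R}.
  by rewrite -exprMn; congr (_ ^+ _); rewrite polyC1; ring.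
have [r ->] := @derivn_exp_root R l l 1 (('X + 1) ^+ l) (leqnn l).
rewrite subnn expr0 mul1r ffactnn -polyC_natr !hornerE subrr mul0r addr0.
by rewrite -[1 + 1]/2 natrM natrX [_%:R * _ ^+ _]mulrC mulVf // -natrX -natrM pnatr_eq0.
Qed.

Definition fact_ratio (R : realType) (l m : nat) : R := ((l - m)`!)%:R / ((l + m)`!)%:R.

Lemma fact_ratioS (R : realType) (l m : nat) : (m < l)%N ->
  fact_ratio R l m = fact_ratio R l m.+1 * ((l%:R - m%:R) * (l%:R + m%:R + 1)).
Proof.
move=> ml; rewrite /fact_ratio addnS factS -(subnSK ml) factS (subnSK ml).
rewrite -natrB ?(ltnW ml) // !natrM -(natr1 (l + m)) natrD.
have h : (l%:R + m%:R + 1 : R) != 0 by rewrite -natrD natr1 pnatr_eq0.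
have h' : ((l + m)`!%:R : R) != 0 by rewrite pnatr_eq0 -lt0n fact_gt0.
by field; rewrite h h'.
Qed.

(** The square of [P_l^m], in which the root of [1 - X^2] disappears, so that the differentiation
    can be carried out on polynomials. *)
Definition assoc_legendre_sqr (R : realType) (l m : nat) : {poly R} :=
  (1 - 'X^2) ^+ m * (legendre R l)^`(m) ^+ 2.

(* With [P] the Legendre polynomial, [c m = (l-m)!/(l+m)!] and
   [W m = (1 - X^2)^m P^(m) P^(m+1)], the differentiated Legendre equation turns
   [(c m * assoc_legendre_sqr m)'] into [c m * W m - c (m-1) * W (m-1)], so the sum telescopes
   and the derivative vanishes. *)
Lemma sum_assoc_legendre_sqr (R : realType) (l : nat) (x : R) :
  (assoc_legendre_sqr R l 0).[x]
    + 2 * \sum_(0 <= m < l) fact_ratio R l m.+1 * (assoc_legendre_sqr R l m.+1).[x] = 1.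
Proof.
set P := legendre R l.
pose S := assoc_legendre_sqr R l 0
  + 2 * \sum_(0 <= m < l) (fact_ratio R l m.+1)%:P * assoc_legendre_sqr R l m.+1.
pose V m := (fact_ratio R l m)%:P * ((1 - 'X^2) ^+ m * P^`(m) * P^`(m.+1)).
have d1 : (1 : {poly R})^`() = 0 by rewrite (deriv_natr R 1).
have dX2 : (1 - 'X^2 : {poly R})^`() = - (2 * 'X).
  by rewrite derivB derivXn d1 /= expr1 sub0r -mulr_natl.
have dV m : (m < l)%N ->
    ((fact_ratio R l m.+1)%:P * assoc_legendre_sqr R l m.+1)^`() = V m.+1 - V m.
  move=> ml; rewrite /V (fact_ratioS R _ _ ml) deriv_mulC /assoc_legendre_sqr -/P.
  set e := fact_ratio _ _ _.
  have fE : ((l%:R - m%:R) * (l%:R + m%:R + 1) : R)%:P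
      = (l%:R - m%:R) * (l%:R + m%:R + 1).
    by rewrite polyCM polyCB !polyCD !polyC_natr polyC1.
  rewrite [(e * _)%:P]polyCM fE derivM !deriv_exp dX2 -!derivnS /=.
  have := legendre_ode R l m; rewrite -/P => ode.
  apply/eqP; rewrite -subr_eq0; apply/eqP.
  transitivity (e%:P * ((1 - 'X^2) ^+ m * P^`(m.+1)) *
     ((1 - 'X^2) * P^`(m.+2) - (2 * m.+1%:R * 'X * P^`(m.+1)
        + (m%:R - l%:R) * (l%:R + m%:R + 1) * P^`(m)))); last by rewrite ode subrr mulr0.
  by rewrite (exprS _ m) expr1; ring.
have dS : S^`() = 0.
  rewrite /S derivD derivM (deriv_natr R 2) mul0r add0r raddf_sum /=.
  rewrite (eq_big_nat _ _ (F2 := fun m => V m.+1 - V m)) => [|m /andP[_ ml]]; last exact: dV.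
  (* The upper boundary term contains the derivative of order [l + 1], zero by degree; the lower
     one, [- 2 P P'] after doubling, cancels the derivative of the [m = 0] term [P^2]. *)
  rewrite telescope_sumr // /V /P [(legendre R l)^`(l.+1)]derivn_poly0 ?size_legendre //.
  rewrite /fact_ratio subn0 addn0 divff ?pnatr_eq0 -?lt0n ?fact_gt0 //.
  by rewrite /assoc_legendre_sqr !expr0 !mul1r derivn0 derivn1 expr2 derivM; ring.
have Sx y : S.[y] = (assoc_legendre_sqr R l 0).[y]
    + 2 * \sum_(0 <= m < l) fact_ratio R l m.+1 * (assoc_legendre_sqr R l m.+1).[y].
  rewrite /S hornerD -[2 in LHS]polyC_natr hornerCM horner_sum; congr (_ + _ * _).
  by apply: eq_bigr => m _; rewrite hornerCM.
have S0 : S = (S`_0)%:P.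
  apply/polyP => -[|i]; rewrite coefC //=.
  have /eqP := congr1 (fun p : {poly R} => p`_i) dS.
  by rewrite coef_deriv coef0 mulrn_eq0 /= => /eqP.
(* Being constant, [S] may be evaluated at 1, where [1 - X^2] kills every term with [m > 0] and
   [P(1)^2 = 1] remains. *)
rewrite -Sx S0 hornerC -(hornerC S`_0 1) -S0 Sx.
rewrite big1 ?mulr0 ?addr0; last first.
  have r0 : (1 - 'X^2 : {poly R}).[1] = 0 by rewrite !hornerE; ring.
  by move=> m _; rewrite /assoc_legendre_sqr exprS -mulrA hornerM r0 mul0r mulr0.
by rewrite /assoc_legendre_sqr expr0 mul1r derivn0 horner_exp legendre1 expr1n.
Qed.

Lemma sqmodM (R : realType) (x y : R[i]) : sqmod (x * y) = sqmod x * sqmod y.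
Proof. by case: x y => [a b] [e f]; rewrite /sqmod /=; ring. Qed.

Lemma sqmod_real (R : realType) (x : R) : sqmod (x%:C)%C = x ^+ 2.
Proof. by rewrite /sqmod /= expr0n addr0. Qed.

Lemma sqmod_conj (R : realType) (x : R[i]) : sqmod (conjc x) = sqmod x.
Proof. by case: x => a b; rewrite /sqmod /= sqrrN. Qed.

(** The phase has modulus one. For negative [m] the factorial ratio in [d_lm^2] is inverted, but the
    squared ratio in the convention for [P_l^{-m}] inverts it back, so the result depends on [|m|]
    only. *)
Lemma sqmod_Ylm (R : realType) (l : nat) (m : int) (theta phi : R) : (`|m| <= l)%N ->
  sqmod (Ylm l m theta phi)
    = (2 * l + 1)%N%:R / (4 * pi)
      * (fact_ratio R l `|m| * (assoc_legendre_sqr R l `|m|).[cos theta]).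
Proof.
move=> ml; rewrite /Ylm sqmodM sqmod_real /sqmod /= cos2Dsin2 mulr1 exprMn.
have f0 n : (n`!%:R : R) != 0 by rewrite pnatr_eq0 -lt0n fact_gt0.
have pi0 : (4 * pi : R) != 0 by rewrite mulf_neq0 ?gt_eqF ?pi_gt0.
rewrite /dcoef exprMn sqr_sqrtr ?divr_ge0 ?mulr_ge0 ?pi_ge0 //.
rewrite sqrr_sign mul1r.
move: (4 * pi : R) pi0 => q q0.
have -> : (assoc_legendre_sqr R l `|m|).[cos theta]
    = (1 - cos theta ^+ 2) ^+ `|m| * ((legendre R l)^`(`|m|)).[cos theta] ^+ 2.
  by rewrite /assoc_legendre_sqr !hornerE.
have c1 : 0 <= 1 - cos theta ^+ 2 by rewrite -sin2cos2 sqr_ge0.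
rewrite /assoc_legendre /fact_ratio.
have sq n : (Num.sqrt (1 - cos theta ^+ 2) ^+ n) ^+ 2 = (1 - cos theta ^+ 2) ^+ n.
  by rewrite -exprM mulnC exprM sqr_sqrtr.
case: (leP 0 m) => m0.
  have -> : absz (l%:Z - m) = (l - `|m|)%N by lia.
  have -> : absz (l%:Z + m) = (l + `|m|)%N by lia.
  by rewrite exprMn sq; field; rewrite q0 f0.
have -> : absz (l%:Z - m) = (l + `|m|)%N by lia.
have -> : absz (l%:Z + m) = (l - `|m|)%N by lia.
rewrite !exprMn exprVn sq sqrr_sign.
by field; rewrite q0 !f0.
Qed.

Lemma sum_abs_centered (R : nmodType) (f : nat -> R) (l : nat) :
  \sum_(j < (2 * l).+1) f (absz (j%:Z - l%:Z))
    = f 0%N + (\sum_(0 <= m < l) f m.+1) *+ 2.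
Proof.
rewrite -(big_mkord predT (fun j => f (absz (j%:Z - l%:Z)))).
rewrite (big_cat_nat _ (n := l)) //=; last by lia.
rewrite addrC big_ltn; last by lia.
rewrite subrr -addrA mulr2n; congr (_ + (_ + _)).
  rewrite -{1}[l.+1]add0n big_addn; have -> : ((2 * l).+1 - l.+1 = l)%N by lia.
  by apply: eq_big_nat => i _; congr f; lia.
by rewrite big_nat_rev /=; apply: eq_big_nat => i ?; congr f; lia.
Qed.

Lemma sum_sqmod_Ylm (R : realType) (l : nat) (theta phi : R) :
  \sum_(j < (2 * l).+1) sqmod (Ylm l (j%:Z - l%:Z) theta phi)
    = (2 * l + 1)%N%:R / (4 * pi).
Proof.
pose f m := (2 * l + 1)%N%:R / (4 * pi)
  * (fact_ratio R l m * (assoc_legendre_sqr R l m).[cos theta]).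
rewrite (eq_bigr (fun j : 'I_(2 * l).+1 => f (absz (j%:Z - l%:Z)))); last first.
  by move=> j _; rewrite sqmod_Ylm //; have := ltn_ord j; lia.
rewrite sum_abs_centered /f -mulr_sumr -mulrnAr -mulrDr -[in X in _ + X]mulr_natl.
rewrite {1}/fact_ratio subn0 addn0 divff ?pnatr_eq0 -?lt0n ?fact_gt0 // mul1r.
by rewrite sum_assoc_legendre_sqr mulr1.
Qed.

Lemma sqmod_Yl00 (R : realType) (l : nat) :
  sqmod (Ylm l 0 0 (0 : R)) = (2 * l + 1)%N%:R / (4 * pi).
Proof.
rewrite sqmod_Ylm // cos0 /fact_ratio /= subn0 addn0.
rewrite divff ?pnatr_eq0 -?lt0n ?fact_gt0 // /assoc_legendre_sqr expr0 mul1r derivn0.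
by rewrite horner_exp legendre1 expr1n !mulr1.
Qed.

(** * Bounds for the time factors [A_l] and [B_l] *)

(** Follows from [1 - exp(-2x) <= 2x]; it bounds [sinh (t K) / K] without dividing by a small
    [K]. *)
Lemma sinh_le_mul_exp (R : realType) (x : R) : 0 <= x -> sinh x <= x * expR x.
Proof.
move=> x0; rewrite /sinh.
have h : expR (- x) >= expR x * (1 - 2 * x).
  have -> : expR (- x) = expR x * expR (- (2 * x)).
    by rewrite -expRD; congr expR; ring.
  by rewrite ler_pM2l ?expR_gt0 //; apply: expR_ge1Dx.
rewrite ler_pdivrMr //; move: h; lra.
Qed.

(** The hyperbolic cosine contributes at most 1 and the other term at most 2 after damping, because
    [K] does not exceed the damping rate [b]. *)
Lemma decay_cosh_sinh_div (R : realType) (b K t : R) :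
  0 < b -> 0 <= K -> K <= b -> 0 < t ->
  0 <= expR (- (b * t)) * (cosh (t * K) + b * sinh_div t K) <= 3.
Proof.
move=> b0 K0 Kb t0.
have bt0 : 0 < b * t by rewrite mulr_gt0.
have tK0 : 0 <= t * K by rewrite mulr_ge0 // ltW.
have tKb : t * K <= b * t by rewrite mulrC ler_pM2r.
have e0 := expR_gt0 (- (b * t)).
have eN : expR (- (b * t)) * expR (b * t) = 1 by rewrite -expRD addNr expR0.
have eK : expR (t * K) <= expR (b * t) by rewrite ler_expR.
have eKN : expR (- (t * K)) <= expR (t * K) by rewrite ler_expR; lra.
have eKp := expR_gt0 (- (t * K)).
have sh0 : 0 <= sinh_div t K.
  rewrite /sinh_div; case: ifP => [_|_]; first exact: ltW.
  by rewrite divr_ge0 // /sinh divr_ge0 // subr_ge0.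
have ch0 : 0 <= cosh (t * K) by rewrite /cosh divr_ge0 // addr_ge0 ?expR_ge0.
have chle : cosh (t * K) <= expR (b * t) by rewrite /cosh; lra.
rewrite mulr_ge0 ?addr_ge0 ?mulr_ge0 ?expR_ge0 ?(ltW b0) //=.
suff sle : b * sinh_div t K <= 2 * expR (b * t).
  have -> : 3 = expR (- (b * t)) * (3 * expR (b * t)) by rewrite mulrCA eN mulr1.
  rewrite ler_pM2l //.
  by apply: le_trans (lerD chle sle) _; lra.
(* For [K >= b / 2] the quotient [b / K] is at most 2. For smaller [K] the growth is at most
   [exp(b t / 2)], and the spare half of the damping absorbs the factor [b t]. *)
case: (leP (b / 2) K) => bK.
  have Kp : 0 < K by apply: lt_le_trans bK; rewrite divr_gt0.
  rewrite /sinh_div gt_eqF // /sinh mulrA ler_pdivrMr //.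
  have : b * ((expR (t * K) - expR (- (t * K))) / 2) <= 2 * K * (expR (b * t) / 2).
    by apply: ler_pM; rewrite ?(ltW b0) ?divr_ge0 ?subr_ge0 //; lra.
  have : 0 <= expR (b * t) * K by rewrite mulr_ge0 ?expR_ge0.
  nra.
have sdle : sinh_div t K <= t * expR (b * t / 2).
  have e1 : 1 <= expR (b * t / 2).
    by rewrite -expR0 ler_expR divr_ge0 // ltW.
  rewrite /sinh_div; case: eqP => [_|/eqP Kn].
    by rewrite ler_peMr // ltW.
  have Kp : 0 < K by rewrite lt_neqAle eq_sym Kn.
  rewrite ler_pdivrMr //; apply: le_trans (sinh_le_mul_exp _ _ tK0) _.
  rewrite -mulrA [leRHS]mulrAC -mulrA ler_pM2l // ler_pM2l //.
  by rewrite ler_expR; nra.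
have e2 : b * t / 2 <= expR (b * t / 2).
  by apply: le_trans (expR_ge1Dx _); lra.
have -> : expR (b * t) = expR (b * t / 2) * expR (b * t / 2).
  by rewrite -expRD; congr expR; field.
apply: le_trans (ler_wpM2l (ltW b0) sdle) _.
by rewrite !mulrA ler_pM2r ?expR_gt0 //; lra.
Qed.

(** [lstar] is the point where the radicands of [K_l] and [K_l'] change sign, which is why it
    separates the two regimes. *)
Lemma lstar_root (R : realType) (c D k : R) : 0 < c -> 0 < D -> 0 < k ->
  c ^+ 2 * (lstar c D k * (lstar c D k + 1)) * k ^+ 2 = c ^+ 4 / (4 * D ^+ 2).
Proof.
move=> c0 D0 k0; rewrite /lstar.
have s2 : Num.sqrt (D ^+ 2 * k ^+ 2 + c ^+ 2) ^+ 2 = D ^+ 2 * k ^+ 2 + c ^+ 2.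
  by rewrite sqr_sqrtr // -exprMn addr_ge0 ?sqr_ge0.
move: (Num.sqrt _) s2 => s s2.
have -> : c ^+ 2 * ((s - D * k) / (2 * D * k) * ((s - D * k) / (2 * D * k) + 1)) * k ^+ 2
    = c ^+ 2 * (s ^+ 2 - D ^+ 2 * k ^+ 2) / (4 * D ^+ 2).
  by field; rewrite (gt_eqF D0) (gt_eqF k0).
by rewrite s2; congr (_ / _); ring.
Qed.

Lemma lstar_ge0 (R : realType) (c D k : R) : 0 < c -> 0 < D -> 0 < k -> 0 <= lstar c D k.
Proof.
move=> c0 D0 k0; apply: divr_ge0; last by rewrite !mulr_ge0 ?(ltW D0) ?(ltW k0).
have Dk : 0 <= D * k by rewrite mulr_ge0 ?ltW.
rewrite subr_ge0 -[leLHS]ger0_norm // -sqrtr_sqr ler_wsqrtr // exprMn.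
by rewrite lerDl sqr_ge0.
Qed.

Lemma Kl'_gt0 (R : realType) (c D k : R) (l : nat) : 0 < c -> 0 < D -> 0 < k ->
  lstar c D k < l%:R -> 0 < Kl' c D k l.
Proof.
move=> c0 D0 k0 lS; rewrite /Kl' sqrtr_gt0 subr_gt0 -(lstar_root _ _ _ _ c0 D0 k0).
have s0 := lstar_ge0 _ _ _ _ c0 D0 k0.
rewrite ltr_pM2r ?exprn_gt0 // ltr_pM2l ?exprn_gt0 // natrM -natr1.
by apply: ltr_pM; lra.
Qed.

Lemma Kl_le (R : realType) (c D k : R) (l : nat) : 0 < c -> 0 < D ->
  Kl c D k l <= c ^+ 2 / (2 * D).
Proof.
move=> c0 D0; have b0 : 0 <= c ^+ 2 / (2 * D) by rewrite divr_ge0 ?sqr_ge0 // mulr_ge0 ?ltW.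
rewrite -[leRHS]ger0_norm // -sqrtr_sqr ler_wsqrtr //.
have -> : (c ^+ 2 / (2 * D)) ^+ 2 = c ^+ 4 / (4 * D ^+ 2).
  by field; rewrite (gt_eqF D0).
by rewrite gerBl mulr_ge0 ?sqr_ge0 // mulr_ge0 ?sqr_ge0.
Qed.

(** Only the amplitude [c^2 / (2 D K_l')] needs control, and it is largest at the smallest
    frequency. *)
Lemma Bl_bounded (R : realType) (c D k : R) : 0 < c -> 0 < D -> 0 < k ->
  exists2 M : R, 0 <= M & forall l t, `|Bl c D k l t| <= M.
Proof.
move=> c0 D0 k0.
have ex : exists n : nat, lstar c D k < n%:R.
  exists (Num.truncn (lstar c D k)).+1; exact: truncnS_gt.
(* The least degree [n] above [lstar] depends on [c], [D], [k] alone, and [K_n'] bounds all later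
   frequencies from below. *)
case: (ex_minnP ex) => n nS nmin.
have Kn := Kl'_gt0 _ _ _ _ _ c0 D0 k0 nS.
exists (1 + c ^+ 2 / (2 * D * Kl' c D k n)).
  by rewrite addr_ge0 // divr_ge0 ?sqr_ge0 // !mulr_ge0 ?ltW.
move=> l t; rewrite /Bl; case: ifP => [lS|_]; last first.
  by rewrite normr0 addr_ge0 // divr_ge0 ?sqr_ge0 // !mulr_ge0 ?ltW.
have Kl0 := Kl'_gt0 _ _ _ _ _ c0 D0 k0 lS.
apply: le_trans (ler_normD _ _) _; apply: lerD.
  by rewrite ler_norml cos_geN1 cos_le1.
rewrite normrM ger0_norm; last by rewrite divr_ge0 ?sqr_ge0 // !mulr_ge0 ?ltW.
rewrite -[leRHS]mulr1; apply: ler_pM => //.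
- by rewrite divr_ge0 ?sqr_ge0 // !mulr_ge0 ?ltW.
- rewrite ler_pM2l ?exprn_gt0 // lef_pV2 ?posrE ?mulr_gt0 // ler_pM2l ?mulr_gt0 //.
  rewrite /Kl' ler_wsqrtr // lerD2r ler_pM2r ?exprn_gt0 // ler_pM2l ?exprn_gt0 //.
  by rewrite ler_nat leq_mul // ?ltnS nmin.
- by rewrite ler_norml sin_geN1 sin_le1.
Qed.

Lemma Al_Bl_bounded (R : realType) (c D k : R) : 0 < c -> 0 < D -> 0 < k ->
  exists2 M : R, 0 <= M & forall l t, 0 < t ->
    `|expR (- (c ^+ 2 * t) / (2 * D)) * (Al c D k l t + Bl c D k l t)| <= M /\
    (lstar c D k < l%:R -> `|Al c D k l t + Bl c D k l t| <= M).
Proof.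
move=> c0 D0 k0; have [M M0 BM] := Bl_bounded _ _ _ _ c0 D0 k0.
(* 3 covers the damped hyperbolic regime and [M] the oscillating one; their sum replaces a
   maximum. *)
exists (3 + M) => [|l t t0]; first by rewrite addr_ge0.
have AS : lstar c D k < l%:R -> Al c D k l t = 0.
  by move=> lS; rewrite /Al leNgt lS.
have e1 : expR (- (c ^+ 2 * t) / (2 * D)) <= 1.
  rewrite -expR0 ler_expR mulNr oppr_le0 divr_ge0 ?mulr_ge0 ?sqr_ge0 // ltW //.
split; last first.
  by move=> lS; rewrite AS // add0r; apply: le_trans (BM l t) _; rewrite lerDr.
case: (ltP (lstar c D k) l%:R) => lS.
  rewrite AS // add0r normrM ger0_norm ?expR_ge0 //.
  apply: (@le_trans _ _ (1 * M)); first by rewrite ler_pM ?expR_ge0.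
  by rewrite mul1r lerDr.
have -> : Bl c D k l t = 0 by rewrite /Bl ltNge lS.
rewrite addr0 /Al lS.
have b0 : 0 < c ^+ 2 / (2 * D) by rewrite divr_gt0 ?exprn_gt0 ?mulr_gt0.
have -> : - (c ^+ 2 * t) / (2 * D) = - (c ^+ 2 / (2 * D) * t) by rewrite mulNr mulrAC.
have /andP[h0 h1] := decay_cosh_sinh_div _ _ _ _ b0 (sqrtr_ge0 _) (Kl_le _ _ _ k l c0 D0) t0.
by rewrite ger0_norm //; apply: le_trans h1 _; rewrite lerDl.
Qed.

(** * Expectations of complex random variables *)

Lemma cexpect_is0 (R : realType) (d : measure_display) (T : measurableType d)
    (P : probability T R) : cexpect_is P (fun _ => 0) 0.
Proof.
have h : (\int[P]_w (0 : R)%:E = 0)%E by apply: integral0_eq.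
by split => //=; apply: integrable0.
Qed.

Lemma cexpect_isD (R : realType) (d : measure_display) (T : measurableType d)
    (P : probability T R) (Z W : T -> R[i]) (z w : R[i]) :
  cexpect_is P Z z -> cexpect_is P W w ->
  cexpect_is P (fun x => Z x + W x) (z + w).
Proof.
move=> [Z1 Z2 Z3 Z4] [W1 W2 W3 W4].
have reD x : (complex.Re (Z x + W x))%:E
    = ((complex.Re (Z x))%:E + (complex.Re (W x))%:E)%E.
  by case: (Z x) (W x) => [? ?] [? ?].
have imD x : (complex.Im (Z x + W x))%:E
    = ((complex.Im (Z x))%:E + (complex.Im (W x))%:E)%E.
  by case: (Z x) (W x) => [? ?] [? ?].
have zw : complex.Re (z + w) = complex.Re z + complex.Re w
    /\ complex.Im (z + w) = complex.Im z + complex.Im w.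
  by case: z w {Z3 Z4 W3 W4} => [? ?] [? ?].
case: zw => zw1 zw2; split.
- by rewrite (funext reD); apply: integrableD.
- by rewrite (funext imD); apply: integrableD.
- by rewrite (funext reD) integralD // Z3 W3 zw1.
- by rewrite (funext imD) integralD // Z4 W4 zw2.
Qed.

Lemma cexpect_isZ (R : realType) (d : measure_display) (T : measurableType d)
    (P : probability T R) (y : R[i]) (Z : T -> R[i]) (z : R[i]) :
  cexpect_is P Z z -> cexpect_is P (fun x => y * Z x) (y * z).
Proof.
case: y => a b [Z1 Z2 Z3 Z4].
have reM x : (complex.Re ((a +i* b)%C * Z x))%:E
    = (a%:E * (complex.Re (Z x))%:E + (- b)%:E * (complex.Im (Z x))%:E)%E.
  by case: (Z x) => [? ?] /=; rewrite -!EFinM -EFinD mulNr.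
have imM x : (complex.Im ((a +i* b)%C * Z x))%:E
    = (a%:E * (complex.Im (Z x))%:E + b%:E * (complex.Re (Z x))%:E)%E.
  by case: (Z x) => [? ?] /=; rewrite -!EFinM -EFinD [b * _]mulrC.
have zE : complex.Re ((a +i* b)%C * z) = a * complex.Re z + (- b) * complex.Im z
    /\ complex.Im ((a +i* b)%C * z) = a * complex.Im z + b * complex.Re z.
  by case: z {Z3 Z4} => [? ?] /=; rewrite mulNr [b * _]mulrC.
have iZ r f : P.-integrable setT f -> P.-integrable setT (fun x => r%:E * f x)%E.
  exact: integrableZl.
case: zE => zE1 zE2; split.
- by rewrite (funext reM); apply: integrableD => //; apply: iZ.
- by rewrite (funext imM); apply: integrableD => //; apply: iZ.
- rewrite (funext reM) integralD //; [|exact: iZ|exact: iZ].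
  by rewrite !integralZl // Z3 Z4 zE1.
- rewrite (funext imM) integralD //; [|exact: iZ|exact: iZ].
  by rewrite !integralZl // Z3 Z4 zE2.
Qed.

Lemma cexpect_is_sum (R : realType) (d : measure_display) (T : measurableType d)
    (P : probability T R) (I : eqType) (s : seq I) (Z : I -> T -> R[i]) (z : I -> R[i]) :
  (forall i, i \in s -> cexpect_is P (Z i) (z i)) ->
  cexpect_is P (fun x => \sum_(i <- s) Z i x) (\sum_(i <- s) z i).
Proof.
elim: s => [|i s IH] h.
  rewrite big_nil (_ : (fun _ => _) = fun _ => 0); first exact: cexpect_is0.
  by apply/funext => x; rewrite big_nil.
rewrite big_cons (_ : (fun _ => _) = fun x => Z i x + \sum_(j <- s) Z j x); last first.
  by apply/funext => x; rewrite big_cons.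
apply: cexpect_isD; first by apply: h; rewrite mem_head.
by apply: IH => j js; apply: h; rewrite in_cons js orbT.
Qed.

Lemma sqmodE (R : realType) (z : R[i]) : sqmod z = complex.Re (z * conjc z).
Proof. by case: z => a b; rewrite /sqmod /=; ring. Qed.

Lemma sqmod_ge0 (R : realType) (z : R[i]) : 0 <= sqmod z.
Proof. by rewrite /sqmod addr_ge0 ?sqr_ge0. Qed.

(** Pythagoras for uncorrelated variables: [|sum|^2] is expanded into a double sum, whose
    off-diagonal terms have zero expectation. Integrability of each product is part of
    [cexpect_is]. *)
Lemma expect_sqmod_sum (R : realType) (d : measure_display) (T : measurableType d)
    (P : probability T R) (I : eqType) (s : seq I) (Z : I -> T -> R[i]) (V : I -> R)
    (y : I -> R[i]) : uniq s ->
  (forall i j, i \in s -> j \in s ->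
     cexpect_is P (fun w => Z i w * conjc (Z j w)) (if i == j then real_complex R (V i) else 0)) ->
  (\int[P]_w (sqmod (\sum_(i <- s) y i * Z i w))%:E
    = (\sum_(i <- s) sqmod (y i) * V i)%:E)%E.
Proof.
move=> us h.
have : cexpect_is P
   (fun w => \sum_(i <- s) \sum_(j <- s) (y i * conjc (y j)) * (Z i w * conjc (Z j w)))
   (\sum_(i <- s) \sum_(j <- s) (y i * conjc (y j)) * (if i == j then real_complex R (V i) else 0)).
  apply: cexpect_is_sum => i si; apply: cexpect_is_sum => j sj.
  by apply: cexpect_isZ; apply: h.
case=> _ _ + _ => e.
transitivity (\int[P]_w (complex.Re
    (\sum_(i <- s) \sum_(j <- s) (y i * conjc (y j)) * (Z i w * conjc (Z j w))))%:E)%E.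
  apply: eq_integral => w _; congr (_%:E); rewrite sqmodE; congr (complex.Re _).
  rewrite (raddf_sum (@conjc R)) mulr_suml; apply: eq_bigr => i _.
  rewrite mulr_sumr; apply: eq_bigr => j _.
  by rewrite /= (rmorphM (@conjc R)) mulrACA.
rewrite e; congr (_%:E).
rewrite (eq_big_seq (fun i => real_complex R (sqmod (y i) * V i))).
  by rewrite -(raddf_sum (real_complex R)).
move=> i si; rewrite (bigD1_seq i) //= eqxx big1 ?addr0.
  case: (y i) => a b; apply/eqP; rewrite eq_complex /sqmod /=.
  by apply/andP; split; apply/eqP; ring.
by move=> j ji; rewrite eq_sym (negbTE ji) mulr0.
Qed.

(** * Measurability of complex functions and of the spherical harmonics *)

(** Componentwise, the form in which measurability of the coefficients and of [U] is assumed. *)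
Definition cmeasurable (R : realType) (d : measure_display) (T : measurableType d)
  (f : T -> R[i]) : Prop :=
  measurable_fun setT (fun x => complex.Re (f x)) /\
  measurable_fun setT (fun x => complex.Im (f x)).

Lemma cmeasurableD (R : realType) (d : measure_display) (T : measurableType d)
    (f g : T -> R[i]) :
  cmeasurable R d T f -> cmeasurable R d T g -> cmeasurable R d T (fun x => f x + g x).
Proof.
move=> [f1 f2] [g1 g2]; split.
  rewrite (_ : (fun _ => _) = fun x => complex.Re (f x) + complex.Re (g x)).
    exact: measurable_funD.
  by apply/funext => x; case: (f x) (g x) => [? ?] [? ?].
rewrite (_ : (fun _ => _) = fun x => complex.Im (f x) + complex.Im (g x)).
  exact: measurable_funD.
by apply/funext => x; case: (f x) (g x) => [? ?] [? ?].
Qed.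

Lemma cmeasurableM (R : realType) (d : measure_display) (T : measurableType d)
    (f g : T -> R[i]) :
  cmeasurable R d T f -> cmeasurable R d T g -> cmeasurable R d T (fun x => f x * g x).
Proof.
move=> [f1 f2] [g1 g2]; split.
  rewrite (_ : (fun _ => _) = fun x => complex.Re (f x) * complex.Re (g x)
      - complex.Im (f x) * complex.Im (g x)).
    by apply: measurable_funB; apply: measurable_funM.
  by apply/funext => x; case: (f x) (g x) => [? ?] [? ?].
rewrite (_ : (fun _ => _) = fun x => complex.Re (f x) * complex.Im (g x)
    + complex.Im (f x) * complex.Re (g x)).
  by apply: measurable_funD; apply: measurable_funM.
by apply/funext => x; case: (f x) (g x) => [? ?] [? ?] /=; ring.
Qed.

Lemma cmeasurable_cst (R : realType) (d : measure_display) (T : measurableType d)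
    (z : R[i]) : cmeasurable R d T (fun _ => z).
Proof. by split; apply: measurable_cst. Qed.

Lemma cmeasurableB (R : realType) (d : measure_display) (T : measurableType d)
    (f g : T -> R[i]) :
  cmeasurable R d T f -> cmeasurable R d T g -> cmeasurable R d T (fun x => f x - g x).
Proof.
move=> mf mg; rewrite (_ : (fun _ => _) = fun x => f x + (-1) * g x).
  apply: cmeasurableD => //; apply: cmeasurableM => //; exact: cmeasurable_cst.
by apply/funext => x; rewrite mulN1r.
Qed.

Lemma cmeasurable_sum (R : realType) (d : measure_display) (T : measurableType d)
    (I : eqType) (s : seq I) (f : I -> T -> R[i]) :
  (forall i, i \in s -> cmeasurable R d T (f i)) ->
  cmeasurable R d T (fun x => \sum_(i <- s) f i x).
Proof.
elim: s => [|i s IH] h.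
  rewrite (_ : (fun _ => _) = fun _ => 0); first exact: cmeasurable_cst.
  by apply/funext => x; rewrite big_nil.
rewrite (_ : (fun _ => _) = fun x => f i x + \sum_(j <- s) f j x); last first.
  by apply/funext => x; rewrite big_cons.
apply: cmeasurableD; first by apply: h; rewrite mem_head.
by apply: IH => j js; apply: h; rewrite in_cons js orbT.
Qed.

Lemma measurable_sqmod (R : realType) (d : measure_display) (T : measurableType d)
    (f : T -> R[i]) : cmeasurable R d T f -> measurable_fun setT (fun x => sqmod (f x)).
Proof. by move=> [f1 f2]; apply: measurable_funD; apply: measurable_funX. Qed.

Lemma measurable_Ylm (R : realType) (l : nat) (m : int) :
  cmeasurable R _ (R * R)%type (fun p => Ylm l m p.1 p.2).
Proof.
have mcos : measurable_fun setT (fun p : R * R => cos p.1).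
  apply: (@measurableT_comp _ _ _ _ _ _ (@cos R)) => //.
  exact: continuous_measurable_fun (@continuous_cos R).
have mpoly (q : {poly R}) : measurable_fun setT (fun p : R * R => q.[cos p.1]).
  rewrite (_ : (fun _ => _) = fun p : R * R => \sum_(i < size q) q`_i * cos p.1 ^+ i).
    apply: measurable_sum => i; apply: measurable_funM => //; exact: measurable_funX.
  by apply/funext => p; rewrite horner_coef.
have msqrt : measurable_fun setT (fun p : R * R => Num.sqrt (1 - cos p.1 ^+ 2)).
  apply: (@measurableT_comp _ _ _ _ _ _ (@Num.sqrt R)).
    exact: continuous_measurable_fun (@sqrt_continuous R).
  by apply: measurable_funB => //; apply: measurable_funX.
have massoc : measurable_fun setT (fun p : R * R => assoc_legendre l m (cos p.1)).
  rewrite /assoc_legendre; case: (0 <= m).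
    by apply: measurable_funM => //; apply: measurable_funX.
  apply: measurable_funM => //; apply: measurable_funM => //; exact: measurable_funX.
have mphi : measurable_fun setT (fun p : R * R => m%:~R * p.2) by apply: measurable_funM.
have h : measurable_fun setT (fun p : R * R => dcoef R l m * assoc_legendre l m (cos p.1)).
  by apply: measurable_funM.
rewrite /Ylm; apply: cmeasurableM; first by split => /=; [exact: h|exact: measurable_cst].
split => /=.
  apply: (@measurableT_comp _ _ _ _ _ _ (@cos R)) => //.
  exact: continuous_measurable_fun (@continuous_cos R).
apply: (@measurableT_comp _ _ _ _ _ _ (@sin R)) => //.
exact: continuous_measurable_fun (@continuous_sin R).
Qed.

(** * The squared norm as an integral over a product space *)

(* The canonical sigma-finite instance on [\x] only fires for subprobabilities, hence a
   constant with its own instances. *)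
Definition plane_measure (R : realType) :
    set (measurableTypeR R * measurableTypeR R)%type -> \bar R :=
  (@lebesgue_measure R \x @lebesgue_measure R)%E.

HB.instance Definition _ (R : realType) := Measure.on (plane_measure R).

Lemma plane_measure_sigma_finite (R : realType) : sigma_finite setT (plane_measure R).
Proof.
pose A (n : nat) : set (measurableTypeR R) := `](- n%:R)%R, n%:R[%classic.
have mA n : measurable (A n) by exact: measurable_itv.
have lA n : (lebesgue_measure (A n) < +oo)%E.
  by rewrite lebesgue_measure_itv /=; case: ifP => _; rewrite -?EFinB ltry.
exists (fun n => A n `*` A n) => [|n]; last first.
  split; first exact: measurableX.
  rewrite /plane_measure product_measure1E //.
  have l0 : (0 <= @lebesgue_measure R (A n))%E by exact: measure_ge0.
  have fA : @lebesgue_measure R (A n) \is a fin_num by rewrite ge0_fin_numE.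
  exact: lte_mul_pinfty l0 fA (lA n).
apply/esym; rewrite -subTset => -[x y] _.
exists (Num.truncn (`|x| + `|y|)).+1 => //=.
have h := truncnS_gt (`|x| + `|y| : R).
rewrite /A /= !in_itv /= -!ltr_norml.
by split; apply: le_lt_trans h; rewrite ?lerDl ?lerDr.
Qed.

HB.instance Definition _ (R : realType) :=
  @Measure_isSigmaFinite.Build _ _ _ (plane_measure R) (plane_measure_sigma_finite R).

(* Density of the surface measure [sin theta dtheta dphi] with respect to the
   Lebesgue measure of the plane. *)
Definition sphere_weight (R : realType) (p : R * R) : R :=
  sin p.1 * \1_(`[0%R, pi[%classic) p.1 * \1_(`[0%R, (2 * pi)%R[%classic) p.2.

Lemma sphere_weight_ge0 (R : realType) (p : R * R) : 0 <= sphere_weight R p.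
Proof.
rewrite /sphere_weight; apply: mulr_ge0; last by rewrite indicE.
rewrite indicE; case: (boolP (_ \in _)) => [|_]; last by rewrite mulr0.
by rewrite inE /= in_itv /= mulr1 => /andP[p0 ppi]; rewrite sin_ge0_pi // p0 ltW.
Qed.

Lemma measurable_sphere_weight (R : realType) : measurable_fun setT (sphere_weight R).
Proof.
have msin : measurable_fun setT (fun p : R * R => sin p.1).
  apply: (@measurableT_comp _ _ _ _ _ _ (@sin R)) => //.
  exact: continuous_measurable_fun (@continuous_sin R).
have mi (A : set R) (f : R * R -> R) : measurable A -> measurable_fun setT f ->
    measurable_fun setT (fun p => \1_A (f p) : R).
  by move=> mA mf; apply: measurableT_comp => //; exact: measurable_indic.
rewrite /sphere_weight; apply: measurable_funM; first apply: measurable_funM => //.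
  exact: (mi _ fst (measurable_itv _)).
exact: (mi _ snd (measurable_itv _)).
Qed.

Lemma L2sq_integrand_ge0 (R : realType) (z : R[i]) (p : R * R) :
  (0 <= (sqmod z * sphere_weight R p)%:E)%E.
Proof. by rewrite lee_fin mulr_ge0 ?sqmod_ge0 ?sphere_weight_ge0. Qed.

Lemma measurable_L2sq_integrand (R : realType) (d : measure_display) (T : measurableType d)
    (X : T -> R -> R -> R[i]) :
  cmeasurable R _ (T * (R * R))%type (fun z => X z.1 z.2.1 z.2.2) ->
  measurable_fun setT (fun z : T * (R * R) =>
    (sqmod (X z.1 z.2.1 z.2.2) * sphere_weight R z.2)%:E).
Proof.
move=> mX; apply/measurable_EFinP; apply: measurable_funM; first exact: measurable_sqmod.
by apply: (@measurableT_comp _ _ _ _ _ _ (sphere_weight R)) => //; exact: measurable_sphere_weight.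
Qed.

(** Tonelli's theorem is applied twice; the restrictions to the coordinate intervals become the
    indicators inside [sphere_weight]. *)
Lemma L2sqE (R : realType) (d : measure_display) (T : measurableType d)
    (P : probability T R) (X : T -> R -> R -> R[i]) :
  cmeasurable R _ (T * (R * R))%type (fun z => X z.1 z.2.1 z.2.2) ->
  (L2sq P X = \int[P \x plane_measure R]_z
     (sqmod (X z.1 z.2.1 z.2.2) * sphere_weight R z.2)%:E)%E.
Proof.
move=> mX; have mI := measurable_L2sq_integrand _ _ _ _ mX.
rewrite fubini_tonelli1 //; last by move=> z; exact: L2sq_integrand_ge0.
apply: eq_integral => w _; rewrite /fubini_F /=.
have mIw : measurable_fun setT (fun p : R * R =>
    (sqmod (X w p.1 p.2) * sphere_weight R p)%:E).
  exact: (measurableT_comp mI (measurable_pair1 w)).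
rewrite fubini_tonelli1 //; last by move=> p; exact: L2sq_integrand_ge0.
rewrite integral_mkcond; apply: eq_integral => theta _; rewrite /fubini_F /=.
rewrite patchE; case: ifPn => th.
  rewrite integral_mkcond; apply: eq_integral => phi _.
  rewrite patchE /sphere_weight /= !indicE th.
  by case: ifPn => ph; rewrite ?mulr1 // !mulr0.
rewrite integral0_eq // => phi _.
by rewrite /sphere_weight /= !indicE (negbTE th) mulr0 mul0r mulr0.
Qed.

(** With the expectation innermost, a bound at each fixed point of the sphere suffices. *)
Lemma L2sq_Fubini (R : realType) (d : measure_display) (T : measurableType d)
    (P : probability T R) (X : T -> R -> R -> R[i]) :
  cmeasurable R _ (T * (R * R))%type (fun z => X z.1 z.2.1 z.2.2) ->
  (L2sq P X = \int[plane_measure R]_p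
     \int[P]_w (sqmod (X w p.1 p.2) * sphere_weight R p)%:E)%E.
Proof.
move=> mX; rewrite L2sqE // fubini_tonelli2 //; first exact: measurable_L2sq_integrand.
by move=> z; exact: L2sq_integrand_ge0.
Qed.

Lemma sqmodD_le (R : realType) (x y : R[i]) : sqmod (x + y) <= 2 * sqmod x + 2 * sqmod y.
Proof.
case: x y => [a b] [e f]; rewrite /sqmod /=.
by have := sqr_ge0 (a - e); have := sqr_ge0 (b - f); nra.
Qed.

Lemma L2sqD_le (R : realType) (d : measure_display) (T : measurableType d)
    (P : probability T R) (X Y : T -> R -> R -> R[i]) :
  cmeasurable R _ (T * (R * R))%type (fun z => X z.1 z.2.1 z.2.2) ->
  cmeasurable R _ (T * (R * R))%type (fun z => Y z.1 z.2.1 z.2.2) ->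
  (L2sq P (fun w th ph => (X w th ph + Y w th ph)%R)
     <= 2%:E * L2sq P X + 2%:E * L2sq P Y)%E.
Proof.
move=> mX mY.
have mXY : cmeasurable R _ (T * (R * R))%type
    (fun z => X z.1 z.2.1 z.2.2 + Y z.1 z.2.1 z.2.2) by apply: cmeasurableD.
have mI := measurable_L2sq_integrand.
have I0 := L2sq_integrand_ge0 R.
rewrite !L2sqE // -!ge0_integralZl //; [|exact: mI|exact: mI].
rewrite -ge0_integralD //; last first.
- by apply: measurable_funeM; exact: mI.
- by move=> z _; rewrite mule_ge0.
- by apply: measurable_funeM; exact: mI.
- by move=> z _; rewrite mule_ge0.
apply: ge0_le_integral => //.
- exact: (mI _ _ _ (fun w th ph => X w th ph + Y w th ph)).
- by apply: emeasurable_funD; apply: measurable_funeM; exact: mI.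
move=> z _; rewrite -!EFinM -EFinD lee_fin.
move: (sphere_weight R z.2) (sphere_weight_ge0 R z.2) => s s0.
by rewrite !mulrA -mulrDl; apply: ler_wpM2r => //; exact: sqmodD_le.
Qed.

(** The bound [sin <= 1] leaves the area [pi * 2 pi] of the coordinate rectangle. The exact value
    [4 pi] would only improve the constant. *)
Lemma integral_sphere_weight_le (R : realType) :
  (\int[plane_measure R]_p (sphere_weight R p)%:E
     <= (2 * pi ^+ 2)%:E)%E.
Proof.
pose A := (`[0%R, pi[%classic : set R) `*` (`[0%R, (2 * pi)%R[%classic : set R).
have mA : measurable A by apply: measurableX.
have le1 p : sphere_weight R p <= \1_A p.
  rewrite /sphere_weight !indicE -mulrA -natrM mulnb.
  have -> : (p \in A) = (p.1 \in (`[0%R, pi[%classic : set R))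
      && (p.2 \in (`[0%R, (2 * pi)%R[%classic : set R)).
    by apply/idP/andP; rewrite !inE => -[].
  by rewrite ler_piMl // sin_le1.
have mlam (x : R) : 0 <= x ->
    (lebesgue_measure (`[0%R, x[%classic : set R) = x%:E)%E.
  rewrite le_eqVlt lebesgue_measure_itv /= lte_fin => /orP[/eqP<-|->].
    by rewrite ltxx.
  by rewrite sube0.
apply: (@le_trans _ _ (\int[plane_measure R]_p (\1_A p)%:E)%E).
  apply: ge0_le_integral => //.
  - by move=> p _; rewrite lee_fin sphere_weight_ge0.
  - by apply/measurable_EFinP; exact: measurable_sphere_weight.
  - by apply/measurable_EFinP; exact: measurable_indic.
  - by move=> p _; rewrite lee_fin.
rewrite integral_indic // setIT.
apply: (@le_trans _ _ (plane_measure R A)) => //.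
have -> : (plane_measure R A = lebesgue_measure (`[0%R, pi[%classic : set R)
    * lebesgue_measure (`[0%R, (2 * pi)%R[%classic : set R))%E.
  by rewrite /plane_measure /A product_measure1E.
rewrite !mlam ?mulr_ge0 ?pi_ge0 //.
by rewrite -EFinM lee_fin expr2 mulrCA.
Qed.

Lemma L2sq_le_cst (R : realType) (d : measure_display) (T : measurableType d)
    (P : probability T R) (X : T -> R -> R -> R[i]) (B : R) : 0 <= B ->
  cmeasurable R _ (T * (R * R))%type (fun z => X z.1 z.2.1 z.2.2) ->
  (forall th ph, (\int[P]_w (sqmod (X w th ph))%:E <= B%:E)%E) ->
  (L2sq P X <= (2 * pi ^+ 2 * B)%:E)%E.
Proof.
move=> B0 mX XB; rewrite L2sq_Fubini //.
have mI := measurable_L2sq_integrand _ _ _ _ mX.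
have I0 := L2sq_integrand_ge0 R.
have mw : measurable_fun setT (fun p => (sphere_weight R p)%:E).
  by apply/measurable_EFinP; exact: measurable_sphere_weight.
apply: (@le_trans _ _ (\int[plane_measure R]_p
    (B%:E * (sphere_weight R p)%:E))%E); last first.
  rewrite ge0_integralZl //; last by move=> p _; rewrite lee_fin sphere_weight_ge0.
  by rewrite mulrC EFinM lee_wpmul2l ?lee_fin // integral_sphere_weight_le.
apply: ge0_le_integral => //.
- by move=> p _; apply: integral_ge0.
- exact: (measurable_fun_fubini_tonelli_G _ mI).
- exact: measurable_funeM.
move=> p _.
have mXp : measurable_fun setT (fun w => (sqmod (X w p.1 p.2))%:E).
  apply/measurable_EFinP.
  exact: (measurableT_comp (measurable_sqmod _ _ _ _ mX) (measurable_pair2 (p : R * R))).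
under eq_integral do rewrite mulrC EFinM.
rewrite ge0_integralZl //; last 2 first.
- by move=> w _; rewrite lee_fin sqmod_ge0.
- by rewrite lee_fin sphere_weight_ge0.
by rewrite muleC lee_wpmul2r ?lee_fin ?sphere_weight_ge0.
Qed.

(** * Second moments of partial sums and the truncation error *)

Lemma usum_split (R : realType) (c D k : R) (d : measure_display) (T : measurableType d)
    (a : nat -> int -> T -> R[i]) (t : R) (L N : nat) (w : T) (th ph : R) : (L <= N)%N ->
  usum c D k a t 0 N w th ph
    = usum c D k a t 0 L w th ph + usum c D k a t L N w th ph.
Proof. by move=> LN; rewrite /usum (big_cat_nat _ (n := L)) //= mulrDr. Qed.

Lemma measurable_usum (R : realType) (c D k : R) (d : measure_display) (T : measurableType d)
    (a : nat -> int -> T -> R[i]) (t : R) (lo hi : nat) :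
  (forall l m, (`|m| <= l)%N -> cmeasurable R d T (a l m)) ->
  cmeasurable R _ (T * (R * R))%type (fun z => usum c D k a t lo hi z.1 z.2.1 z.2.2).
Proof.
move=> ma; have mcst := cmeasurable_cst R _ (T * (R * R))%type.
rewrite /usum; apply: cmeasurableM; first exact: mcst.
apply: cmeasurable_sum => l _; apply: cmeasurable_sum => j _.
have jl : (absz (j%:Z - l%:Z) <= l)%N by have := ltn_ord j; lia.
have [m1 m2] := ma _ _ jl; have [y1 y2] := measurable_Ylm R l (j%:Z - l%:Z).
apply: cmeasurableM.
  split; first exact: (measurableT_comp y1 measurable_snd).
  exact: (measurableT_comp y2 measurable_snd).
rewrite /xi; apply: cmeasurableM; last exact: mcst.
apply: cmeasurableM; last exact: mcst.
apply: cmeasurableM; first exact: mcst.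
split; first exact: (measurableT_comp m1 measurable_fst).
exact: (measurableT_comp m2 measurable_fst).
Qed.

(** In each [xi] the factor [4 pi / (2 l + 1)] cancels [|Y_l0|^2] at the pole, and the sum over [m]
    removes the dependence on the angles. *)
Lemma expect_sqmod_usum (R : realType) (c D k : R) (d : measure_display)
    (T : measurableType d) (P : probability T R) (a : nat -> int -> T -> R[i]) (Cl : nat -> R)
    (t : R) (lo hi : nat) (th ph : R) :
  (forall l m l' m', (`|m| <= l)%N -> (`|m'| <= l')%N ->
     cexpect_is P (fun w => a l m w * conjc (a l' m' w))
       (if (l == l') && (m == m') then real_complex R (Cl l) else 0)) ->
  (\int[P]_w (sqmod (usum c D k a t lo hi w th ph))%:E
    = (\sum_(lo <= l < hi)
        (expR (- (c ^+ 2 * t) / (2 * D)) * (Al c D k l t + Bl c D k l t)) ^+ 2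
          * ((2 * l + 1)%N%:R * Cl l) / (4 * pi))%:E)%E.
Proof.
move=> ha; set e := expR _.
(* [y] gathers the deterministic factors of [a_lm]; with [s] listing the pairs [(l, m)], the double
   sum becomes one sum over uncorrelated variables. *)
pose y (p : nat * int) : R[i] := ((e%:C * Ylm p.1 p.2 th ph)
  * ((Num.sqrt (4 * pi / (2 * p.1 + 1)%N%:R))%:C * conjc (Ylm p.1 0 0 0)
      * (Al c D k p.1 t + Bl c D k p.1 t)%:C))%C.
pose s := [seq (l, j%:Z - l%:Z) | l <- index_iota lo hi, j <- index_iota 0 (2 * l).+1].
have sP p : p \in s -> (`|p.2| <= p.1)%N.
  by case/allpairsPdep => l [j [_ + ->]]; rewrite mem_index_iota /=; lia.
have us : uniq s.
  apply: allpairs_uniq_dep; first exact: iota_uniq.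
    by move=> l _; exact: iota_uniq.
  by case=> [l j] [l' j'] /= _ _ [<- /addIr [<-]].
have usumE w : usum c D k a t lo hi w th ph = \sum_(p <- s) y p * a p.1 p.2 w.
  rewrite big_allpairs_dep /usum mulr_sumr; apply: eq_bigr => l _.
  rewrite big_mkord mulr_sumr; apply: eq_bigr => j _.
  by rewrite /y /xi /=; ring.
transitivity (\int[P]_w (sqmod (\sum_(p <- s) y p * a p.1 p.2 w))%:E)%E.
  by apply: eq_integral => w _; rewrite usumE.
rewrite (expect_sqmod_sum _ _ _ _ _ _ (fun p => a p.1 p.2) (fun p => Cl p.1) _ us); last first.
  move=> [l m] [l' m'] ps ps'; rewrite xpair_eqE.
  by apply: ha; [exact: (sP _ ps)|exact: (sP _ ps')].
congr (_%:E); rewrite big_allpairs_dep; apply: eq_bigr => l _.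
have pi0 : (4 * pi : R) != 0 by rewrite mulf_neq0 ?gt_eqF ?pi_gt0.
have l0 : (2 * l%:R + 1 : R) != 0 by rewrite -natrM natr1 pnatr_eq0.
have sq : Num.sqrt (4 * pi / (2 * l + 1)%N%:R) ^+ 2 = 4 * pi / (2 * l + 1)%N%:R :> R.
  by rewrite sqr_sqrtr // divr_ge0 ?mulr_ge0 ?pi_ge0.
have yE x u v (Y W : R[i]) : sqmod (x%:C * Y * (u%:C * W * v%:C))%C
    = x ^+ 2 * sqmod Y * (u ^+ 2 * sqmod W * v ^+ 2).
  by rewrite !sqmodM !sqmod_real.
under eq_bigr do rewrite /y yE sqmod_conj sqmod_Yl00 /=.
rewrite -!mulr_suml -mulr_sumr big_mkord sum_sqmod_Ylm sq exprMn.
move: (4 * pi : R) pi0 => q q0.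
by field; rewrite q0 l0.
Qed.

(** [C_l] is the expectation of [|a_l0|^2]. The sign makes the partial sums of the power spectrum
    monotone. *)
Lemma Cl_ge0 (R : realType) (d : measure_display) (T : measurableType d)
    (P : probability T R) (a : nat -> int -> T -> R[i]) (Cl : nat -> R) :
  isotropic_gaussian_coeffs P a Cl -> forall l, 0 <= Cl l.
Proof.
move=> [_ [_ [_ [_ [ha _]]]]] l.
have [_ _ + _] := ha l 0 l 0 (leq0n l) (leq0n l).
rewrite !eqxx /= => h; rewrite -lee_fin -h; apply: integral_ge0 => w _.
by rewrite -sqmodE lee_fin sqmod_ge0.
Qed.

Lemma L2sq_usum_le (R : realType) (c D k : R) (d : measure_display)
    (T : measurableType d) (P : probability T R) (a : nat -> int -> T -> R[i]) (Cl : nat -> R)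
    (t K : R) (L N : nat) :
  isotropic_gaussian_coeffs P a Cl ->
  (forall l, (L <= l)%N ->
    `|expR (- (c ^+ 2 * t) / (2 * D)) * (Al c D k l t + Bl c D k l t)| <= K) ->
  (L2sq P (usum c D k a t L N)
    <= (pi / 2 * K ^+ 2 * \sum_(L <= l < N) (2 * l + 1)%N%:R * Cl l)%:E)%E.
Proof.
move=> ha hK; have C0 := Cl_ge0 _ _ _ _ _ _ ha.
have [ma [_ [_ [_ [cov _]]]]] := ha.
set S := \sum_(_ <= _ < _) _.
have S0 : 0 <= S by apply: sumr_ge0 => l _; rewrite mulr_ge0.
(* The area bound [2 pi^2] is separated from the pointwise second moment with its [1 / (4 pi)]. *)
have -> : pi / 2 * K ^+ 2 * S = 2 * pi ^+ 2 * (K ^+ 2 * S / (4 * pi)).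
  have p0 : (pi : R) != 0 by rewrite gt_eqF ?pi_gt0.
  by move: (pi : R) p0 => q q0; field.
apply: L2sq_le_cst.
- by apply: divr_ge0; [exact: mulr_ge0 (sqr_ge0 _) S0|rewrite mulr_ge0 ?pi_ge0].
- exact: measurable_usum.
move=> th ph; rewrite (expect_sqmod_usum _ _ _ _ _ _ _ _ _ _ _ _ _ _ cov) lee_fin.
rewrite -mulr_suml ler_pM2r ?invr_gt0 ?mulr_gt0 ?pi_gt0 // /S mulr_sumr.
rewrite big_nat_cond [leRHS]big_nat_cond.
apply: ler_sum => l /andP[/andP[Ll _] _]; apply: ler_wpM2r; first by rewrite mulr_ge0.
by rewrite -real_normK ?num_real // lerXn2r ?nnegrE ?(le_trans _ (hK l Ll)) // hK.
Qed.

(** The error is split at a degree [N >= L] so large that [u - u_N] is negligible; the block from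
    [L] to [N] is bounded by the full tail because its terms are nonnegative. The split doubles
    [pi / 2] to [pi]. *)
Lemma L2sq_error_le (R : realType) (c D k : R) (d : measure_display)
    (T : measurableType d) (P : probability T R) (a : nat -> int -> T -> R[i]) (Cl : nat -> R)
    (t K : R) (U : T -> R -> R -> R[i]) (L : nat) :
  isotropic_gaussian_coeffs P a Cl ->
  cvg (series (fun l : nat => (2 * l + 1)%N%:R * Cl l) @ \oo) ->
  cmeasurable R _ (T * (R * R))%type (fun z => U z.1 z.2.1 z.2.2) ->
  (fun N : nat => L2sq P (fun w th ph => U w th ph - usum c D k a t 0 N w th ph))
    @ \oo --> 0%E ->
  (forall l, (L <= l)%N ->
    `|expR (- (c ^+ 2 * t) / (2 * D)) * (Al c D k l t + Bl c D k l t)| <= K) ->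
  (L2sq P (fun w th ph => (U w th ph - usum c D k a t 0 L w th ph)%R)
    <= (pi * K ^+ 2
        * limn (fun n : nat => \sum_(L <= l < n) (2 * l + 1)%N%:R * Cl l))%:E)%E.
Proof.
move=> ha cC mU /fine_cvgP[fU cU] hK; set tail := limn _.
have C0 := Cl_ge0 _ _ _ _ _ _ ha; have [ma _] := ha.
apply/lee_addgt0Pr => e e0.
(* Half of [e], since [L2sqD_le] doubles the contribution of [u - u_N]. *)
have e20 : 0 < e / 2 by rewrite divr_gt0.
have [N0 _ hN] : \forall N \near \oo, L2sq P (fun w th ph =>
    U w th ph - usum c D k a t 0 N w th ph) \is a fin_num /\
    fine (L2sq P (fun w th ph => U w th ph - usum c D k a t 0 N w th ph)) < e / 2.
  by apply: filterI => //; apply: (cvgr_lt _ cU).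
pose N := maxn L N0; have [fN eN] := hN N (leq_maxr L N0).
have LN : (L <= N)%N := leq_maxl L N0.
have hsum : \sum_(L <= l < N) (2 * l + 1)%N%:R * Cl l <= tail.
  apply: (nondecreasing_cvgn_le (u_ := fun n => \sum_(L <= l < n) (2 * l + 1)%N%:R * Cl l)).
    by apply: nondecreasing_series => l _ _; rewrite mulr_ge0.
  by rewrite is_cvg_series_restrict.
have -> : (fun w th ph => U w th ph - usum c D k a t 0 L w th ph)
    = fun w th ph => (U w th ph - usum c D k a t 0 N w th ph) + usum c D k a t L N w th ph.
  by apply/funext => w; apply/funext => th; apply/funext => ph;
    rewrite (usum_split _ _ _ _ _ _ _ _ _ _ _ _ _ LN); ring.
apply: le_trans (L2sqD_le _ _ _ _ _ _ _ _) _.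
- by apply: cmeasurableB => //; apply: measurable_usum.
- exact: measurable_usum.
have {}eN : (2%:E * L2sq P (fun w th ph => (U w th ph - usum c D k a t 0 N w th ph)%R)
    <= e%:E)%E.
  by rewrite -(fineK fN) -EFinM lee_fin; move: eN; lra.
have K0 : 0 <= pi / 2 * K ^+ 2 by rewrite mulr_ge0 ?sqr_ge0 // divr_ge0 ?pi_ge0.
have tE : (pi * K ^+ 2 * tail)%:E = (2%:E * (pi / 2 * K ^+ 2 * tail)%:E)%E.
  by rewrite -EFinM; congr (_%:E); move: (pi : R) => q; field.
rewrite addeC tE; apply: leeD => //; apply: lee_wpmul2l; first by rewrite lee_fin.
apply: le_trans (L2sq_usum_le _ _ _ _ _ _ _ _ _ _ K L N ha hK) _.
by rewrite lee_fin ler_wpM2l.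
Qed.

Lemma L2norm_le (R : realType) (d : measure_display) (T : measurableType d)
    (P : probability T R) (X : T -> R -> R -> R[i]) (K s : R) : 0 <= K ->
  (L2sq P X <= (pi * K ^+ 2 * s)%:E)%E ->
  (L2norm P X <= (Num.sqrt pi * K * Num.sqrt s)%:E)%E.
Proof.
move=> K0; rewrite /L2norm; case: (L2sq P X) => [r| |] //=; rewrite ?leNye //.
rewrite !lee_fin => h; apply: le_trans (ler_wsqrtr h) _.
by rewrite -mulrA sqrtrM ?pi_ge0 // sqrtrM ?sqr_ge0 // sqrtr_sqr ger0_norm // mulrA.
Qed.

Theorem theorem3 (R : realType) (c D k : R) (hc : 0 < c) (hD : 0 < D) (hk : 0 < k) :
  exists C : R,
  forall (d : measure_display) (T : measurableType d) (P : probability T R)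
         (a : nat -> int -> T -> R[i]) (Cl : nat -> R),
    isotropic_gaussian_coeffs P a Cl ->
    cvg (series (fun l : nat => (2 * l + 1)%N%:R * Cl l) @ \oo) ->
  forall (t : R), 0 < t ->
  (* u(.,.,t) : the L_2(Omega x S^2) limit of the series *)
  forall U : T -> R -> R -> R[i],
    measurable_fun setT (fun p : (T * (R * R))%type => complex.Re (U p.1 p.2.1 p.2.2)) ->
    measurable_fun setT (fun p : (T * (R * R))%type => complex.Im (U p.1 p.2.1 p.2.2)) ->
    (fun N : nat => L2sq P (fun w th ph => U w th ph - usum c D k a t 0 N w th ph))
      @ \oo --> 0%E ->
  forall L : nat,
    let err := fun w th ph => U w th ph - usum c D k a t 0 L w th ph in
    let tail := limn (fun n : nat => \sum_(L <= l < n) (2 * l + 1)%N%:R * Cl l) in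
    (L2norm P err <= (C * Num.sqrt tail)%:E)%E /\
    (lstar c D k < L%:R ->
       (L2norm P err <= (C * expR (- (c ^+ 2 * t) / (2 * D)) * Num.sqrt tail)%:E)%E).
Proof.
have [M M0 hM] := Al_Bl_bounded _ _ _ _ hc hD hk.
(* [C] is fixed before the probability space, the spectrum, [t] and [L], so it depends on [c], [D],
   [k] only. *)
exists (Num.sqrt pi * M) => d T P a Cl ha cC t t0 U mU1 mU2 cU L err tail.
split=> [|LS].
  apply: L2norm_le => //; apply: L2sq_error_le => // l _.
  by have [] := hM l t t0.
(* Now [K = M e]: every degree [l >= L] lies above [lstar], where [A_l + B_l] is bounded without
   damping and the exponential survives as a factor. *)
rewrite -[Num.sqrt pi * M * _]mulrA; apply: L2norm_le; first by rewrite mulr_ge0 ?expR_ge0.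
apply: L2sq_error_le => // l Ll.
rewrite normrM [`|expR _|]ger0_norm ?expR_ge0 // mulrC ler_wpM2r ?expR_ge0 //.
have [_] := hM l t t0; apply.
by apply: lt_le_trans LS _; rewrite ler_nat.
Qed.
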